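(* Let $k\ge 3$ and $n\ge k+2$ be integers. Then $F(G_{k,2}^{(n)}) > F(G_{k+1,2}^{(n)})$.
   Context: All graphs are finite and simple. The F-index of a graph $G$ is $F(G)=\sum_{v\in V(G)} d_G(v)^3$. ''Attaching $m$ leaves to a vertex $x$'' means adding $m$ new vertices each adjacent only to $x$. For $3\le k\le n-1$, $G_{k,2}^{(n)}$ is the $n$-vertex graph obtained from the cycle $C_k$ by attaching $n-k-1$ leaves to one cycle vertex $u$ and one leaf to a cycle vertex adjacent to $u$. *)

(* Defs.v *)
From mathcomp Require Import all_boot.

Set Implicit Arguments.
Unset Strict Implicit.
Unset Printing Implicit Defensive.

Record sgraph := SGraph {
  vertex :> finType;
  adj : rel vertex;
  adj_sym : symmetric adj;
  adj_irrefl : irreflexive adj }.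

Definition deg (G : sgraph) (x : G) : nat := #|[set y : G | adj x y]|.

Definition F_index (G : sgraph) : nat := \sum_(x : G) deg x ^ 3.

Section Cycle.
Variable k : nat.

(* [ordS i] is i + 1 modulo k.  The conjunct [i != j] is redundant for k >= 2;
   it only makes the relation irreflexive for k = 1. *)
Definition cycle_adj : rel 'I_k :=
  fun i j => (i != j) && ((j == ordS i) || (i == ordS j)).

Lemma cycle_adj_sym : symmetric cycle_adj.
Proof. by move=> i j; rewrite /cycle_adj eq_sym orbC. Qed.

Lemma cycle_adj_irrefl : irreflexive cycle_adj.
Proof. by move=> i; rewrite /cycle_adj eqxx. Qed.

Definition cycle_graph : sgraph := SGraph cycle_adj_sym cycle_adj_irrefl.
End Cycle.

Section AttachLeaves.
Variables (G : sgraph) (x : G) (m : nat).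

Definition attach_adj : rel (G + 'I_m) := fun a b =>
  match a, b with
  | inl y, inl z => adj y z
  | inl y, inr _ => y == x
  | inr _, inl z => z == x
  | inr _, inr _ => false
  end.

Lemma attach_adj_sym : symmetric attach_adj.
Proof. by move=> [y|i] [z|j] //=; apply: adj_sym. Qed.

Lemma attach_adj_irrefl : irreflexive attach_adj.
Proof. by move=> [y|i] //=; apply: adj_irrefl. Qed.

Definition attach_leaves : sgraph := SGraph attach_adj_sym attach_adj_irrefl.
End AttachLeaves.

(* Meaningful when 3 <= k <= n - 1 and u, v are adjacent on the cycle; the
   truncated subtraction is then the true one. *)
Definition Gk2 (n k : nat) (u v : cycle_graph k) : sgraph :=
  let G1 := attach_leaves u (n - k - 1) in
  attach_leaves (inl v : G1) 1.

Lemma card_Gk2 n k (u v : cycle_graph k) : k < n -> #|Gk2 n u v| = n.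
Proof.
by move=> lt_kn; rewrite !card_sum !card_ord -subnDA addnAC addn1 subnKC.
Qed.

(* Main.v *)
Require Import Defs.
From mathcomp Require Import all_boot.
From mathcomp Require Import zify.

(* Attaching [m] leaves to [x] changes the F-index by
   [(deg x + m) ^ 3 - deg x ^ 3 + m].  Applied twice to a cycle this gives, with
   [m = n - k], the value [(m + 1) ^ 3 + 27 + 8 (k - 2) + m], so the two sides
   differ by [3 m ^ 2 + 3 m - 6], which is positive as soon as [m >= 2]. *)

Lemma deg_sum (G : sgraph) (x : G) : deg x = \sum_(y : G) adj x y.
Proof. by rewrite /deg cardsE -sum1_card big_mkcond. Qed.

Lemma deg_attach_inl (G : sgraph) (x : G) (m : nat) (y : G) :
  deg (inl y : attach_leaves x m) = deg y + (y == x) * m.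
Proof.
by rewrite !deg_sum big_sumType /= sum_nat_const card_ord mulnC.
Qed.

Lemma deg_attach_inr (G : sgraph) (x : G) (m : nat) (i : 'I_m) :
  deg (inr i : attach_leaves x m) = 1.
Proof.
rewrite deg_sum big_sumType /= [X in _ + X]big1 // addn0 (bigD1 x) //= eqxx.
by rewrite big1 // => y /negbTE ->.
Qed.

(** Among the old vertices only [x] changes degree, and each leaf contributes 1. The old cube stands
    on the left to avoid truncated subtraction. *)
Lemma F_index_attach (G : sgraph) (x : G) (m : nat) :
  F_index (attach_leaves x m) + deg x ^ 3 = F_index G + (deg x + m) ^ 3 + m.
Proof.
rewrite /F_index big_sumType /=.
under eq_bigr do rewrite deg_attach_inl.
under [X in _ + X + _]eq_bigr do rewrite deg_attach_inr.
rewrite sum1_card card_ord (bigD1 x) //= [in RHS](bigD1 x) //= eqxx mul1n.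
under eq_bigr => y /negbTE yx do rewrite yx mul0n addn0.
lia.
Qed.

Lemma deg_cycle_graph (k : nat) (u : cycle_graph k) : 3 <= k -> deg u = 2.
Proof.
move=> k_ge3.
have ordS_neq (i : 'I_k) : i != ordS i.
  apply/eqP => /(congr1 val) /=; have := ltn_ord i.
  rewrite leq_eqVlt => /orP[/eqP ik|lt_ik]; last by rewrite modn_small //; lia.
  by rewrite ik modnn; lia.
have ordS2_neq (i : 'I_k) : ordS (ordS i) != i.
  apply/eqP => /(congr1 val) /=; rewrite -addn1 modnDml addn1.
  (* Either [i + 2] does not wrap around, or it reduces to [i + 2 - k], which differs from [i]
     because [k] is not 2. *)
  have := ltn_ord i; case: (ltnP i.+2 k) => [lt_ik _|le_ki lt_ik].
    by rewrite modn_small //; lia.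
  by rewrite -(subnK le_ki) modnDr modn_small; lia.
have -> : deg u = #|[set ordS u; ord_pred u]|.
  apply: eq_card => j; rewrite !inE /= /cycle_adj.
  have -> : (u == ordS j) = (j == ord_pred u).
    by rewrite eq_sym; apply: (can2_eq (@ordSK k) (@ord_predK k)).
  apply: andb_idl => /orP[] /eqP ->; first exact: ordS_neq.
  by rewrite -{1}[u]ord_predK eq_sym; apply: ordS_neq.
(* Applying the injective [ordS] to both neighbours reduces their distinctness to
   [ordS (ordS u) != u]. *)
by rewrite cards2 -(inj_eq (@ordS_inj k)) ord_predK ordS2_neq.
Qed.

Lemma F_index_cycle_graph (k : nat) : 3 <= k -> F_index (cycle_graph k) = 8 * k.
Proof.
move=> k_ge3; rewrite /F_index.
under eq_bigr do rewrite deg_cycle_graph //.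
by rewrite sum_nat_const card_ord mulnC.
Qed.

(** The 16 collects the cubes [2 ^ 3] that [u] and [v] had on the bare cycle; 27 is the new cube of
    [v], of degree 3. *)
Lemma F_index_Gk2 (n k : nat) (u v : cycle_graph k) :
  3 <= k -> k < n -> adj u v ->
  F_index (Gk2 n u v) + 16 = 8 * k + (n - k).+1 ^ 3 + 27 + (n - k).
Proof.
move=> k_ge3 lt_kn adj_uv.
have v_neq_u : (v == u) = false.
  by apply/negP => /eqP vu; move: adj_uv; rewrite vu adj_irrefl.
have := F_index_attach _ (inl v : attach_leaves u (n - k - 1)) 1.
have := F_index_attach _ u (n - k - 1).
rewrite deg_attach_inl v_neq_u !deg_cycle_graph // F_index_cycle_graph //.
have -> : 2 + (n - k - 1) = (n - k).+1 by lia.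
rewrite -/(Gk2 n u v) /=; lia.
Qed.

Theorem theorem2 (n k : nat) (hk : 3 <= k) (hn : k + 2 <= n)
    (u v : cycle_graph k) (huv : adj u v)
    (u' v' : cycle_graph k.+1) (huv' : adj u' v') :
  F_index (Gk2 n u v) > F_index (Gk2 n u' v').
Proof.
have lt_kn : k.+1 < n by lia.
have := F_index_Gk2 n k u v hk (ltnW lt_kn) huv.
have := F_index_Gk2 n k.+1 u' v' (leqW hk) lt_kn huv'.
(* All differences are rewritten through [n - k], so that the cubes involve one variable [m]; at
   [m = 1] both sides would be equal. *)
have -> : (n - k.+1).+1 = n - k by lia.
have : 2 <= n - k by lia.
have -> : n - k.+1 = (n - k).-1 by lia.
move: (n - k) => m; nia.
Qed.
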